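(* Let $n$ be an integer with $5 \leq n < 9$. For every integer $N \geq n$, the set of typical coranks of $S = ([N]\times[N]) \setminus \{(i,i) : 1 \leq i \leq n\}$ is exactly $\{2\}$. (In the paper's notation: $\mathrm{tc}(G(n,1)^{\mathsf c}) = \{2\}$ for $5 \leq n < 9$.)
   Context: $[N] = \{1,\ldots,N\}$. For $S \subseteq [N]\times[N]$ (the specified entries), a partial filling is a point $A \in \mathbb{R}^S$. A real completion of $A$ is a matrix $M \in \mathbb{R}^{N\times N}$ with $M_{ij} = A_{ij}$ for all $(i,j)\in S$. An integer $r$ is a typical rank of $S$ if there is a nonempty Euclidean open subset of $\mathbb{R}^S$ such that for every $A$ in it, the minimum rank among all real completions of $A$ equals $r$. The typical coranks of $S$ are the numbers $N - r$ with $r$ a typical rank of $S$. For a finite set $U$ of unspecified entries, $\mathrm{tc}(U^{\mathsf c})$ denotes the set of typical coranks of $([N]\times[N])\setminus U$, for any $N$ with $U \subseteq [N]\times[N]$ (this does not depend on $N$). $G(n,1) = \{(i,i) : 1 \leq i \leq n\}$. *)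

(* Defs.v *)
From mathcomp Require Import all_boot all_order all_algebra.
From mathcomp Require Import all_classical all_reals all_analysis.
Import numFieldNormedType.Exports.

Set Implicit Arguments.
Unset Strict Implicit.
Unset Printing Implicit Defensive.

Local Open Scope classical_set_scope.

(* On the finite index type of the specified entries, the topology of pointwise
   convergence is the product topology, i.e. the Euclidean topology of R^S. *)
Definition partial_filling (R : realType) (N : nat) (S : {set 'I_N * 'I_N}) :=
  {ptws {ij : 'I_N * 'I_N | ij \in S} -> R}.

Definition is_completion (R : realType) (N : nat) (S : {set 'I_N * 'I_N})
    (A : partial_filling R S) (M : 'M[R]_N) : Prop :=
  forall (i j : 'I_N) (ijS : (i, j) \in S), M i j = A (exist _ (i, j) ijS).

Definition is_min_completion_rank (R : realType) (N : nat)
    (S : {set 'I_N * 'I_N}) (A : partial_filling R S) (r : nat) : Prop :=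
  (exists2 M : 'M[R]_N, is_completion A M & \rank M = r) /\
  (forall M : 'M[R]_N, is_completion A M -> r <= \rank M).

Definition typical_rank (R : realType) (N : nat) (S : {set 'I_N * 'I_N})
    (r : nat) : Prop :=
  exists O : set (partial_filling R S),
    [/\ open O, O !=set0 & forall A, O A -> is_min_completion_rank A r].

(* A typical rank is at most N, so the subtraction never truncates. *)
Definition typical_coranks (R : realType) (N : nat) (S : {set 'I_N * 'I_N}) :
    set nat :=
  [set k | exists2 r, typical_rank R S r & k = N - r].

(* Indices of 'I_N start at 0: these are the first n diagonal positions. *)
Definition diag_positions (N n : nat) : {set 'I_N * 'I_N} :=
  [set ij : 'I_N * 'I_N | (ij.1 == ij.2) && (ij.1 < n)]%SET.

(* Main.v *)
(* A matrix of rank [<= N - 3] is determined by [N - 3] of its rows and by the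
   coefficients that express the other rows in terms of these, that is, by
   [N^2 - 9] parameters. There are [N^2 - n > N^2 - 9] specified entries, and they
   are polynomials in the parameters, so they satisfy a nontrivial algebraic
   relation, which fails on a dense open set of fillings: corank [3] is excluded
   there. Conversely, a completion of corank [2] exists outside a hypersurface.
   Fixing arbitrarily all diagonal entries but the first five and taking a Schur
   complement reduces this to a 5 x 5 matrix with free diagonal, where two kernel
   vectors can be written down as rational functions of the other entries. *)
Require Import Defs.
From mathcomp Require Import all_boot all_order all_algebra.
From mathcomp Require Import all_classical all_reals all_analysis.
From mathcomp Require Import ring zify.

Section CorankTwo.

Set Implicit Arguments.
Unset Strict Implicit.
Unset Printing Implicit Defensive.
Import Order.TTheory GRing.Theory Num.Theory.
Import numFieldNormedType.Exports.
Local Open Scope classical_set_scope.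
Local Open Scope ring_scope.

Variable R : realType.

(** * Polynomial functions *)

(** Polynomial functions are encoded as an inductive closure, so that continuity, restriction to a
    line and expansion into monomials all follow by induction on the construction of the
    function. *)
Inductive polyfun (T : Type) : ((T -> R) -> R) -> Prop :=
| polyfun_const c : polyfun (fun=> c)
| polyfun_proj t : polyfun (fun x => x t)
| polyfunD f g : polyfun f -> polyfun g -> polyfun (fun x => f x + g x)
| polyfunM f g : polyfun f -> polyfun g -> polyfun (fun x => f x * g x).

Lemma eq_polyfun (T : Type) (f g : (T -> R) -> R) :
  polyfun f -> f =1 g -> polyfun g.
Proof. by move=> + /funext <-. Qed.

Lemma polyfun_sum (T I : Type) (r : seq I) (P : pred I)
    (F : I -> (T -> R) -> R) :
  (forall i, P i -> polyfun (F i)) ->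
  polyfun (fun x => \sum_(i <- r | P i) F i x).
Proof.
move=> polyF; elim: r => [|i r IHr].
  by apply: eq_polyfun (polyfun_const _ _) _ => x; rewrite big_nil.
have [Pi|/negbTE nPi] := boolP (P i).
  by apply: eq_polyfun (polyfunD (polyF i Pi) IHr) _ => x; rewrite big_cons Pi.
by apply: eq_polyfun IHr _ => x; rewrite big_cons nPi.
Qed.

Lemma polyfun_prod (T I : Type) (r : seq I) (P : pred I)
    (F : I -> (T -> R) -> R) :
  (forall i, P i -> polyfun (F i)) ->
  polyfun (fun x => \prod_(i <- r | P i) F i x).
Proof.
move=> polyF; elim: r => [|i r IHr].
  by apply: eq_polyfun (polyfun_const _ _) _ => x; rewrite big_nil.
have [Pi|/negbTE nPi] := boolP (P i).
  by apply: eq_polyfun (polyfunM (polyF i Pi) IHr) _ => x; rewrite big_cons Pi.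
by apply: eq_polyfun IHr _ => x; rewrite big_cons nPi.
Qed.

Lemma polyfunN (T : Type) (f : (T -> R) -> R) :
  polyfun f -> polyfun (fun x => - f x).
Proof.
move=> polyf; apply: eq_polyfun (polyfunM (polyfun_const _ (-1)) polyf) _ => x.
exact: mulN1r.
Qed.

Lemma polyfunX (T : Type) (f : (T -> R) -> R) k :
  polyfun f -> polyfun (fun x => f x ^+ k).
Proof.
move=> polyf; elim: k => [|k IHk].
  exact: eq_polyfun (polyfun_const _ 1) _.
by apply: eq_polyfun (polyfunM polyf IHk) _ => x; rewrite exprS.
Qed.

Lemma polyfun_det (T : Type) n (A : (T -> R) -> 'M[R]_n) :
  (forall i j, polyfun (fun x => A x i j)) -> polyfun (fun x => \det (A x)).
Proof.
move=> polyA; rewrite /determinant; apply: polyfun_sum => s _.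
by apply: polyfunM; [exact: polyfun_const|exact: polyfun_prod].
Qed.

(** A nonzero [p] has fewer than [size p] roots, so one of the [size p] distinct points
    [e / (k + 1)] is not a root. *)
Lemma exists_nonroot (p : {poly R}) (e : R) :
  p != 0 -> 0 < e -> exists2 z, 0 < z <= e & p.[z] != 0.
Proof.
move=> p0 e0; apply: contrapT => noz.
pose rs := [seq e / k.+1%:R | k <- iota 0 (size p)].
suff /(max_poly_roots p0) : all (root p) rs.
  rewrite size_map size_iota ltnn map_inj_uniq ?iota_uniq => [/(_ isT)//|].
  move=> i j /(mulfI (lt0r_neq0 e0))/invr_inj/eqP.
  by rewrite eqr_nat eqSS => /eqP.
apply/allP => _ /mapP[k _ ->]; rewrite rootE.
apply: contrapT => /negP nroot; apply: noz; exists (e / k.+1%:R) => //.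
by rewrite divr_gt0//= ler_pdivrMr// ler_peMr ?ler1n// ltW.
Qed.

(** * Monomial expansions and algebraic dependence *)

Section FiniteIndex.
Variable T : finType.

(** The strict bound [d] applies to each exponent separately, which leaves exactly [d ^ #|T|]
    monomials to count. *)
Definition box_span d (f : (T -> R) -> R) :=
  exists c : {ffun T -> 'I_d} -> R,
    forall x, f x = \sum_a c a * \prod_t x t ^+ a t.

(** Repeated monomials are collected by exponent vector, so monomials may be indexed by any
    convenient finite type. *)
Lemma box_spanI d (I : finType) (c : I -> R) (m : I -> T -> nat) f :
  (forall i t, m i t < d)%N ->
  (forall x, f x = \sum_i c i * \prod_t x t ^+ m i t) -> box_span d f.
Proof.
move=> md fE; pose a i := [ffun t => Ordinal (md i t)].
exists (fun b => \sum_(i | a i == b) c i) => x.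
rewrite fE (partition_big a xpredT)//=; apply: eq_bigr => b _.
rewrite big_distrl/=; apply: eq_bigr => i /eqP <-.
by congr (_ * _); apply: eq_bigr => t _; rewrite ffunE.
Qed.

Lemma eq_box_span d f g : box_span d f -> f =1 g -> box_span d g.
Proof. by move=> + /funext <-. Qed.

Lemma box_spanW d d' f : (d <= d')%N -> box_span d f -> box_span d' f.
Proof.
move=> dd' [c fE]; apply: (box_spanI (c := c) (m := fun a t => a t)) => // a t.
exact: leq_trans dd'.
Qed.

Lemma box_span_const c : box_span 1 (fun=> c).
Proof.
apply: (@box_spanI _ unit (fun=> c) (fun _ _ => 0%N)) => // x.
by rewrite big_const cardT enumT unlock /= addr0 big1 ?mulr1.
Qed.

Lemma box_span_proj t : box_span 2 (fun x => x t).
Proof.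
apply: (@box_spanI _ unit (fun=> 1) (fun _ s => s == t)) => [_ s|x].
  by case: (s == t).
rewrite big_const cardT enumT unlock /= addr0 mul1r (bigD1 t)//= eqxx expr1.
by rewrite big1 ?mulr1// => s /negbTE ->.
Qed.

Lemma box_spanD d e f g :
  box_span d f -> box_span e g -> box_span (maxn d e) (fun x => f x + g x).
Proof.
move=> [c fE] [b gE].
apply: (@box_spanI _ ({ffun T -> 'I_d} + {ffun T -> 'I_e})%type
  (fun i => match i with inl i => c i | inr i => b i end)
  (fun i t => match i with inl i => i t | inr i => i t end)).
- by case=> i t; rewrite leq_max ltn_ord ?orbT.
- by move=> x; rewrite big_sumType/= fE gE.
Qed.

Lemma box_spanM d e f g :
  box_span d f -> box_span e g -> box_span (d + e) (fun x => f x * g x).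
Proof.
move=> [c fE] [b gE].
apply: (@box_spanI _ ({ffun T -> 'I_d} * {ffun T -> 'I_e})%type
  (fun i => c i.1 * b i.2) (fun i t => i.1 t + i.2 t)%N).
- by move=> [i j] t; rewrite /= -addnS leq_add// ltnW.
- move=> x; rewrite fE gE big_distrl/=.
  under eq_bigr do rewrite big_distrr/=.
  rewrite pair_bigA/=; apply: eq_bigr => -[i j] _ /=; rewrite mulrACA.
  by congr (_ * _); rewrite -big_split; apply: eq_bigr => t _; rewrite exprD.
Qed.

Lemma polyfun_box_span f : polyfun f -> exists d, box_span d f.
Proof.
elim=> [c|t|{}f g _ [d fd] _ [e ge]|{}f g _ [d fd] _ [e ge]].
- by exists 1%N; exact: box_span_const.
- by exists 2; exact: box_span_proj.
- by exists (maxn d e); exact: box_spanD.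
- by exists (d + e)%N; exact: box_spanM.
Qed.

Lemma box_spanX d f k : box_span d f -> box_span (k * d).+1 (fun x => f x ^+ k).
Proof.
move=> fd; elim: k => [|k IHk]; first exact: box_span_const.
rewrite mulSn -addnS; apply: eq_box_span (box_spanM fd IHk) _ => x.
by rewrite exprS.
Qed.

Lemma box_span_prod (I : Type) (r : seq I) d (F : I -> (T -> R) -> R) :
  (forall i, box_span d (F i)) ->
  box_span (size r * d).+1 (fun x => \prod_(i <- r) F i x).
Proof.
move=> Fd; elim: r => [|i r IHr].
  by apply: eq_box_span (box_span_const _) _ => x; rewrite big_nil.
rewrite mulSn -addnS; apply: eq_box_span (box_spanM (Fd i) IHr) _ => x.
by rewrite big_cons.
Qed.

(** Uniqueness of expansions in base [d]: the remainder modulo [d] gives the lowest digit, the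
    quotient gives the others. *)
Lemma digits_inj d m (f g : nat -> nat) :
  (forall i, f i < d)%N -> (forall i, g i < d)%N ->
  (\sum_(i < m) f i * d ^ i = \sum_(i < m) g i * d ^ i)%N ->
  forall i, (i < m)%N -> f i = g i.
Proof.
elim: m f g => // m IHm f g fd gd.
have d0 : (0 < d)%N by exact: leq_trans (fd 0%N).
have split_low (h : nat -> nat) : (\sum_(i < m.+1) h i * d ^ i =
    (\sum_(i < m) h i.+1 * d ^ i) * d + h 0)%N.
  rewrite big_ord_recl expn0 muln1 addnC big_distrl/=; congr addn.
  by apply: eq_bigr => i _; rewrite /bump/= expnSr mulnA.
rewrite !split_low => eqfg.
have eq0 : f 0%N = g 0%N.
  by have := congr1 (modn^~ d) eqfg; rewrite !modnMDl !modn_small.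
case=> [//|i] ltim; apply: (IHm (f \o S) (g \o S)) => //=.
have := congr1 (divn^~ d) eqfg.
by rewrite !divnMDl// !divn_small// !addn0.
Qed.

(* Kronecker's substitution [x_i = z ^ (d ^ i)] separates the monomials. *)
Lemma box_poly_neq0 d (u : {ffun T -> 'I_d} -> R) a0 : u a0 != 0 ->
  exists x : T -> R, \sum_a u a * \prod_t x t ^+ a t != 0.
Proof.
move=> ua0; pose w (a : {ffun T -> 'I_d}) :=
  (\sum_(i < #|T|) a (enum_val i) * d ^ i)%N.
have w_inj : injective w.
  move=> a b; rewrite /w => eqw; apply/ffunP => t; apply: val_inj.
  pose dig (c : {ffun T -> 'I_d}) i := nat_of_ord (c (nth t (enum T) i)).
  have E (c : {ffun T -> 'I_d}) : (\sum_(i < #|T|) c (enum_val i) * d ^ i =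
      \sum_(i < #|T|) dig c i * d ^ i)%N.
    by apply: eq_bigr => i _; rewrite (enum_val_nth t).
  have := @digits_inj d #|T| (dig a) (dig b) _ _ _ (enum_rank t) (ltn_ord _).
  by rewrite /dig nth_enum_rank; apply => //; rewrite -!E.
pose p := \sum_a u a *: 'X^(w a) : {poly R}.
have p0 : p != 0.
  (* Since [w] is injective, only [a0] contributes to the coefficient of degree [w a0]. *)
  apply: contraNneq ua0 => p0; have := congr1 (fun q : {poly R} => q`_(w a0)) p0.
  rewrite coef0 coef_sum (bigD1 a0)//= big1 ?addr0 => [|a aa0].
    by rewrite coefZ coefXn eqxx mulr1 => ->.
  by rewrite coefZ coefXn (inj_eq w_inj) eq_sym (negbTE aa0) mulr0.
have [z _ pz] := exists_nonroot p0 ltr01.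
exists (fun t => z ^+ (d ^ enum_rank t)); move: pz; apply: contra_neq => <-.
rewrite horner_sum; apply: eq_bigr => a _; rewrite hornerZ hornerXn.
congr (_ * _); rewrite (reindex (@enum_val T T))/=; last first.
  exact/onW_bij/enum_val_bij.
rewrite -prodrXr; apply: eq_bigr => i _.
by rewrite enum_valK -exprM mulnC.
Qed.

End FiniteIndex.

(* There are more monomials in the coordinates of [F] than monomials in [z] of
   the degrees that they can reach. *)
Lemma algebraic_dependence (T U : finType) (F : T -> (U -> R) -> R) :
  (#|U| < #|T|)%N -> (forall t, polyfun (F t)) ->
  exists Q : (T -> R) -> R, [/\ polyfun Q, exists x, Q x != 0 &
    forall z, Q (F^~ z) = 0].
Proof.
move=> ltUT polyF.
have /fin_all_exists[D0 FD0] : forall t, exists d, box_span d (F t).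
  by move=> t; exact: polyfun_box_span.
pose D := (\max_t D0 t)%N.
have FD t : box_span D (F t) by apply: box_spanW (FD0 t); exact: leq_bigmax.
(* As [d] exceeds [C ^ #|U|], one has [(C * d) ^ #|U| < d ^ (#|U| + 1) <= d ^ #|T|]. With
   [B <= C * d], the [d ^ #|T|] monomials in [F] outnumber the [B ^ #|U|] monomials in [z]. *)
pose C := (#|T| * D.+1).+1; pose d := (C ^ #|U|).+1.
pose B := (#|T| * (d * D).+1).+1.
have leBC : (B <= C * d)%N.
  rewrite /B /C; have : (0 < d)%N by [].
  by move: (d) => k; nia.
have FB (a : {ffun T -> 'I_d}) : box_span B (fun z => \prod_t F t z ^+ a t).
  have -> : B = (size (index_enum T) * (d * D).+1).+1.
    by rewrite /B -sum1_card -sum1_size.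
   apply: box_span_prod => t.
  apply: box_spanW (box_spanX _ (FD t)).
  by rewrite ltnS leq_mul2r ltnW ?orbT.
have /fin_all_exists[c cE] := FB.
pose M := \matrix_(i < #|{ffun T -> 'I_d}|, j < #|{ffun U -> 'I_B}|)
  c (enum_val i) (enum_val j).
(* Row [a] of [M] expands the monomial [a] in [F]. There are more rows than columns, so the rows are
   dependent, and a relation between them gives the coefficients of [Q]. *)
have : kermx M != 0.
  rewrite kermx_eq0 /row_free neq_ltn (leq_ltn_trans (rank_leq_col M))//.
  rewrite !card_ffun !card_ord (@leq_ltn_trans ((C * d) ^ #|U|))//.
    by case: (#|U|) => // k; rewrite leq_exp2r.
  rewrite (@leq_trans (d ^ #|U|.+1)) ?leq_pexp2l//.
  by rewrite expnMn expnSr mulnC ltn_pmul2l ?ltnSn// expn_gt0.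
move=> /rowV0Pn[v /sub_kermxP vM /rV0Pn[k vk]].
pose u a := v 0 (enum_rank a).
exists (fun x => \sum_a u a * \prod_t x t ^+ a t); split.
- apply: polyfun_sum => a _; apply: polyfunM; first exact: polyfun_const.
  by apply: polyfun_prod => t _; apply: polyfunX; exact: polyfun_proj.
- by apply: (@box_poly_neq0 _ _ _ (enum_val k)); rewrite /u enum_valK.
move=> z; under eq_bigr do rewrite cE big_distrr/=.
rewrite exchange_big/= big1// => b _.
under eq_bigr do rewrite mulrA; rewrite -big_distrl/=.
suff -> : \sum_a u a * c a b = 0 by rewrite mul0r.
have /rowP/(_ (enum_rank b)) := vM; rewrite !mxE => vMb; rewrite -[RHS]vMb.
rewrite (reindex (@enum_rank {ffun T -> 'I_d}))/=; last first.
  exact/onW_bij/enum_rank_bij.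
by apply: eq_bigr => a _; rewrite /u !mxE !enum_rankK.
Qed.

(** * Restriction to lines, nonvanishing and density *)

Lemma polyfun_line (T : Type) (f : (T -> R) -> R) (x y : T -> R) :
  polyfun f -> exists p : {poly R},
    forall t, f (fun s => x s + t * (y s - x s)) = p.[t].
Proof.
elim=> [c|s|{}f g _ [p fp] _ [q gq]|{}f g _ [p fp] _ [q gq]].
- by exists c%:P => t; rewrite hornerC.
- exists ((x s)%:P + (y s - x s) *: 'X) => t.
  by rewrite hornerD hornerC hornerZ hornerX mulrC.
- by exists (p + q) => t; rewrite hornerD fp gq.
- by exists (p * q) => t; rewrite hornerM fp gq.
Qed.

Lemma line0 (T : Type) (x y : T -> R) : (fun s => x s + 0 * (y s - x s)) = x.
Proof. by apply/funext => s; rewrite mul0r addr0. Qed.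

Lemma line1 (T : Type) (x y : T -> R) : (fun s => x s + 1 * (y s - x s)) = y.
Proof. by apply/funext => s; rewrite mul1r addrC subrK. Qed.

(** On the line through [x] and [y] both functions restrict to nonzero polynomials in one variable,
    and so does their product. *)
Lemma polyfunM_neq0 (T : Type) (f g : (T -> R) -> R) :
  polyfun f -> polyfun g -> (exists x, f x != 0) -> (exists y, g y != 0) ->
  exists z, f z * g z != 0.
Proof.
move=> polyf polyg [x fx] [y gy].
have [p fp] := polyfun_line x y polyf; have [q gq] := polyfun_line x y polyg.
have p0 : p != 0.
  apply: contraNneq fx => p0; have := fp 0.
  by rewrite line0 p0 horner0 => ->.
have q0 : q != 0.
  apply: contraNneq gy => q0; have := gq 1.
  by rewrite line1 q0 horner0 => ->.
have [|t _ pqt] := @exists_nonroot (p * q) 1 _ ltr01; first by rewrite mulf_neq0.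
by exists (fun s => x s + t * (y s - x s)); rewrite fp gq -hornerM.
Qed.

Lemma polyfun_prod_neq0 (T I : Type) (r : seq I) (P : pred I)
    (F : I -> (T -> R) -> R) :
  (forall i, P i -> polyfun (F i)) ->
  (forall i, P i -> exists x, F i x != 0) ->
  exists x, \prod_(i <- r | P i) F i x != 0.
Proof.
move=> polyF F0; elim: r => [|i r IHr].
  by exists (fun=> 0); rewrite big_nil oner_neq0.
have [Pi|nPi] := boolP (P i); last first.
  by have [x Fx] := IHr; exists x; rewrite big_cons (negbTE nPi).
have := polyfunM_neq0 (polyF _ Pi) (polyfun_prod r polyF) (F0 _ Pi) IHr.
by move=> [x Fx]; exists x; rewrite big_cons Pi.
Qed.

Lemma polyfun_continuous (T : choiceType) (f : (T -> R) -> R) :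
  polyfun f -> forall x : {ptws T -> R}, f @ nbhs x --> f x.
Proof.
elim=> [c|t|{}f g _ fC _ gC|{}f g _ fC _ gC] x.
- exact: (@cvg_cst R c {ptws T -> R} (nbhs x)).
- exact: (@proj_continuous T (fun=> R) t x).
- by apply: (@cvgD R _ {ptws T -> R} (nbhs x)); [exact: fC|exact: gC].
- by apply: (@cvgM R {ptws T -> R} (nbhs x)); [exact: fC|exact: gC].
Qed.

Lemma open_polyfun_neq0 (T : choiceType) (f : (T -> R) -> R) :
  polyfun f -> open ([set x | f x != 0] : set {ptws T -> R}).
Proof.
move=> /polyfun_continuous fC.
have -> : [set x | f x != 0] = (f : {ptws T -> R} -> R) @^-1` ~` [set 0].
  by apply/seteqP; split => x /= /eqP.
apply: open_comp => [x _|]; first exact: fC.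
by apply: closed_openC; exact: closed_eq.
Qed.

(** On the line from a point [x] of [O] to a point [y] with [f y != 0], [f] restricts to a nonzero
    polynomial, which has nonroots arbitrarily close to the parameter 0 of [x]. *)
Lemma polyfun_neq0_dense (T : choiceType) (f : (T -> R) -> R)
    (O : set {ptws T -> R}) :
  polyfun f -> (exists y, f y != 0) -> open O -> O !=set0 ->
  exists2 z, O z & f z != 0.
Proof.
move=> polyf [y fy] oO [x Ox]; have [p fp] := polyfun_line x y polyf.
have p0 : p != 0.
  apply: contraNneq fy => p0; have := fp 1.
  by rewrite line1 p0 horner0 => ->.
pose L (t : R) : {ptws T -> R} := fun s => x s + t * (y s - x s).
have Lcvg : L t @[t --> (0 : R)] --> (x : {ptws T -> R}).
  have FL : Filter (L t @[t --> (0 : R)]) by exact: fmap_filter.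
  (* Convergence in the product topology is checked one coordinate at a time. *)
  apply/cvg_sup => s U [V] [[W] oW <-] Wxs WU; apply: (filterS WU).
  have : L t s @[t --> (0 : R)] --> x s.
    rewrite -[X in _ --> X s](line0 x y); apply: cvgD; first exact: cvg_cst.
    by apply: cvgM; [exact: cvg_id|exact: cvg_cst].
  by apply; exact: open_nbhs_nbhs.
have /nbhs_ballP[e /= e0 Oe] : nbhs (0 : R) (L @^-1` O).
  by apply: Lcvg; exact: open_nbhs_nbhs.
have [t /andP[t0 te] pt] := @exists_nonroot p (e / 2) p0 (divr_gt0 e0 (ltr0Sn _ 1)).
exists (L t); last by rewrite fp.
apply: Oe; rewrite /ball/= sub0r normrN gtr0_norm// (le_lt_trans te)//.
by rewrite ltr_pdivrMr// ltr_pMr// ltr1n.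
Qed.

(** * Lower bound on the rank *)

(** [maxrankfun] selects rows that form a basis of the row space. [X] is square so that a
    coefficient is labelled by the index in [J] of its basis row. *)
Lemma row_set_span (N : nat) (M : 'M[R]_N) :
  exists J : {set 'I_N}, exists X : 'M[R]_N, #|J| = \rank M /\
    forall i j, M i j = \sum_(l in J) X i l * M l j.
Proof.
pose f := maxrankfun M; exists [set f l | l in 'I_(\rank M)]%SET.
have /submxP[D MD] : (M <= rowsub f M)%MS by rewrite eq_maxrowsub.
exists (\matrix_(i, j) \sum_(l | f l == j) D i l); split.
  by rewrite card_imset ?card_ord//; exact: maxrankfun_inj.
move=> i j; rewrite {1}MD mxE big_imset/=; last first.
  by move=> ? ? _ _; exact: maxrankfun_inj.
apply: eq_bigr => l _; rewrite !mxE (bigD1 l)//= big1 ?addr0// => l' /andP[].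
by move=> /eqP/maxrankfun_inj ->; rewrite eqxx.
Qed.

(** Each possible set [J] of spanning rows yields a relation [Q J] between the specified entries. A
    matrix of rank at most [N - k] admits some such [J], so the product of all these relations
    vanishes on its entries. *)
Lemma generic_rank_gt (N k : nat) (S : {set 'I_N * 'I_N}) :
  (k <= N)%N -> (N * N - k * k < #|S|)%N ->
  exists G : ({ij | ij \in S} -> R) -> R,
    [/\ polyfun G, exists x, G x != 0 &
    forall (A : partial_filling R S) (M : 'M[R]_N),
      is_completion A M -> G A != 0 -> (N - k < \rank M)%N].
Proof.
move=> kN ltS.
have Q_ex (J : {set 'I_N}) : exists Q : ({ij | ij \in S} -> R) -> R,
    (#|J| <= N - k)%N -> [/\ polyfun Q, exists x, Q x != 0 &
      forall (A : partial_filling R S) M X, is_completion A M ->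
        (forall i j, M i j = \sum_(l in J) X i l * M l j) -> Q A = 0].
  have [leJ|_] := leqP #|J| (N - k); last by exists (fun=> 0).
  (* The parameters: a pair with row in [J] stands for an entry of [M], any other pair for a
     coefficient in [X]. There are [N ^ 2 - (N - #|J|) ^ 2] of them. The default 0 of [ext] is never
     read by [F]. *)
  pose U : finType := {p : 'I_N * 'I_N | (p.1 \in J) || (p.2 \in J)}.
  pose ext (z : U -> R) p := oapp z 0 (insub p).
  have polyext p : polyfun (ext^~ p).
    by rewrite /ext; case: insub => [u|]; [exact: polyfun_proj|exact: polyfun_const].
  pose F (t : {ij | ij \in S}) : (U -> R) -> R :=
    if (val t).1 \in J then ext^~ (val t)
    else fun z => \sum_(l in J) ext z ((val t).1, l) * ext z (l, (val t).2).
  have ltUS : (#|U| < #|{: {ij | ij \in S}}|)%N.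
    rewrite !card_sig; apply: leq_ltn_trans ltS.
    have := cardC [pred p : 'I_N * 'I_N | (p.1 \in J) || (p.2 \in J)].
    rewrite card_prod card_ord => <-.
    have -> : #|[predC [pred p : 'I_N * 'I_N | (p.1 \in J) || (p.2 \in J)]]| =
        (#|~: J| * #|~: J|)%N.
      rewrite -cardsX -cardsE; apply: eq_card => -[i j].
      by rewrite !inE /= negb_or.
    have kJ : (k <= #|~: J|)%N by have := cardsC J; rewrite card_ord; lia.
    by rewrite -addnBA ?leq_mul// leq_addr.
  have polyF t : polyfun (F t).
    rewrite /F; case: ifP => _; first exact: polyext.
    by apply: polyfun_sum => l _; exact: polyfunM.
  have [Q [polyQ Q0 QF]] := algebraic_dependence ltUS polyF.
  exists Q => _; split=> // A M X AM MX.
  pose z (u : U) := if (val u).1 \in J then M (val u).1 (val u).2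
    else X (val u).1 (val u).2.
  have -> : A = F^~ z; last exact: QF.
  have extz p : (p.1 \in J) || (p.2 \in J) ->
      ext z p = if p.1 \in J then M p.1 p.2 else X p.1 p.2.
    by move=> pJ; rewrite /ext insubT.
  apply/funext => -[[i j] ijS]; rewrite -AM /F/=.
  case: ifPn => iJ; first by rewrite extz/= iJ.
  rewrite MX; apply: eq_bigr => l lJ; rewrite !extz/= ?lJ ?orbT//.
  by rewrite (negbTE iJ).
have [Q Q_prop] := fin_all_exists Q_ex.
exists (fun x => \prod_(J : {set 'I_N} | (#|J| <= N - k)%N) Q J x); split.
- by apply: polyfun_prod => J /Q_prop[].
- by apply: polyfun_prod_neq0 => J /Q_prop[].
move=> A M AM; rewrite ltnNge; apply: contra_neqN => leM.
have [J [X [cardJ MX]]] := row_set_span M.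
rewrite (bigD1 J) ?cardJ//= (_ : Q J A = 0) ?mul0r//.
by have [|_ _ QA] := Q_prop J; [rewrite cardJ|exact: QA AM MX].
Qed.

(** * Completions of corank two *)

(** The determinant of the 3 x 3 matrix with columns [a], [b], [c]. *)
Definition det3 (a b c : nat -> R) :=
  a 0%N * (b 1%N * c 2%N - b 2%N * c 1%N) - a 1%N * (b 0%N * c 2%N - b 2%N * c 0%N)
  + a 2%N * (b 0%N * c 1%N - b 1%N * c 0%N).

(** This expands, along its first row, a 4 x 4 determinant with columns [a], [b], [c], [d] in which
    row [i] occurs twice. *)
Lemma det3_Cramer (a b c d : nat -> R) i : (i < 3)%N ->
  det3 b c d * a i - det3 a c d * b i + det3 a b d * c i - det3 a b c * d i = 0.
Proof. by move: i => [|[|[|//]]] _; rewrite /det3; ring. Qed.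

(* The choice of the diagonal entries [2], [3], [4] puts
   [(0, 0, ker_v2, ker_v3, ker_v4)] in the kernel: it is the cross product of the
   rows [0] and [1] of the last three columns. With these entries, the column
   [kcol k] lists the coefficients in the rows [2], [3], [4] of the [k]-th unknown
   in a second kernel vector [(w0, w1, q2 * ker_v2, q3 * ker_v3, 0)]; Cramer's rule
   solves for it, and the diagonal entries [0] and [1] take care of the two
   remaining rows. *)
Section FiveByFive.
Variable h : nat -> nat -> R.

Definition ker_v2 := h 0 3 * h 1 4 - h 0 4 * h 1 3.
Definition ker_v3 := h 0 4 * h 1 2 - h 0 2 * h 1 4.
Definition ker_v4 := h 0 2 * h 1 3 - h 0 3 * h 1 2.

Definition kcol0 i := h i.+2 0.
Definition kcol1 i := h i.+2 1.
(** In row 2 the diagonal entry has denominator [ker_v2], which cancels against the factor [ker_v2];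
    the column stays polynomial in [h]. The same happens in row 3 of [kcol3]. *)
Definition kcol2 i := match i with
  | 0 => - (h 2 3 * ker_v3 + h 2 4 * ker_v4) | _ => h i.+2 2 * ker_v2 end.
Definition kcol3 i := match i with
  | 1 => - (h 3 2 * ker_v2 + h 3 4 * ker_v4) | _ => h i.+2 3 * ker_v3 end.

(** The factors are, up to sign, the denominators of the five diagonal entries: [ker_v2], [ker_v3],
    [ker_v4], then [w0] and [w1]. *)
Definition nondegenerate5 :=
  ker_v2 * ker_v3 * ker_v4 * det3 kcol1 kcol2 kcol3 * det3 kcol0 kcol2 kcol3.

Lemma corank2_completion5 : nondegenerate5 != 0 ->
  exists (x : 'I_5 -> R) (K : 'M[R]_(5, 2)), \rank K = 2%N /\
    (\matrix_(i, j) if i == j then x i else h i j) *m K = 0.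
Proof.
pose w0 := det3 kcol1 kcol2 kcol3; pose w1 := - det3 kcol0 kcol2 kcol3.
pose q2 := det3 kcol0 kcol1 kcol3; pose q3 := - det3 kcol0 kcol1 kcol2.
have cramer i : (i < 3)%N ->
    w0 * kcol0 i + w1 * kcol1 i + q2 * kcol2 i + q3 * kcol3 i = 0.
  by move=> /(det3_Cramer kcol0 kcol1 kcol2 kcol3) <-; rewrite /w0 /w1 /q2 /q3; ring.
have E2 := cramer 0%N isT; have E3 := cramer 1%N isT; have E4 := cramer 2%N isT.
have V0 : h 0 2 * ker_v2 + h 0 3 * ker_v3 + h 0 4 * ker_v4 = 0.
  by rewrite /ker_v2 /ker_v3 /ker_v4; ring.
have V1 : h 1 2 * ker_v2 + h 1 3 * ker_v3 + h 1 4 * ker_v4 = 0.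
  by rewrite /ker_v2 /ker_v3 /ker_v4; ring.
rewrite /nondegenerate5 -[det3 kcol0 kcol2 kcol3]opprK -/w0 -/w1.
rewrite !mulf_eq0 oppr_eq0 !negb_or => /andP[/andP[/andP[/andP[]]]].
move: E2 E3 E4; rewrite /kcol0 /kcol1 /kcol2 /kcol3.
move: w0 w1 q2 q3 {cramer} V0 V1 => w0 w1 q2 q3.
move: ker_v2 ker_v3 ker_v4 => v2 v3 v4 V0 V1 E2 E3 E4 v2n v3n v4n w0n w1n.
(* Entries 0 and 1 solve rows 0 and 1 for [w], entries 2 to 4 solve the other rows for [v]. The
   remaining equations are [V0], [V1] for [v] and [E2], [E3], [E4] for [w]. *)
pose x := [:: - (h 0 1 * w1 + h 0 2 * (q2 * v2) + h 0 3 * (q3 * v3)) / w0;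
  - (h 1 0 * w0 + h 1 2 * (q2 * v2) + h 1 3 * (q3 * v3)) / w1;
  - (h 2 3 * v3 + h 2 4 * v4) / v2; - (h 3 2 * v2 + h 3 4 * v4) / v3;
  - (h 4 2 * v2 + h 4 3 * v3) / v4].
pose v := [:: 0; 0; v2; v3; v4]; pose w := [:: w0; w1; q2 * v2; q3 * v3; 0].
exists (fun i => x`_i).
exists (\matrix_(i, j) if j == 0 then v`_i else w`_i); split.
  apply/eqP; rewrite eqn_leq rank_leq_col/=.
  (* [L] is a left inverse of [K], obtained by inverting the minor of rows 0 and 2, whose
     determinant is [- w0 * v2]. *)
  pose l := [:: - (q2 * v2) / (w0 * v2); 0; v2^-1; 0; 0].
  pose l' := [:: w0^-1; 0; 0; 0; 0].
  pose L := \matrix_(i < 2, j < 5) if i == 0 then l`_j else l'`_j.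
  set K := \matrix_(i, j) _; suff LK : L *m K = 1%:M.
    by have := mxrankM_maxr L K; rewrite LK mxrank1.
  apply/matrixP => i j; rewrite !mxE !big_ord_recl big_ord0 !mxE /=.
  case: i j => [[|[|//]] ?] [[|[|//]] ?]; rewrite /=.
  - by field; rewrite v2n.
  - by field; rewrite v2n w0n.
  - by ring.
  - by field; rewrite w0n.
apply/matrixP => i j; rewrite !mxE !big_ord_recl big_ord0 !mxE /=.
case: i j => [[|[|[|[|[|//]]]]] ?] [[|[|//]] ?]; rewrite /bump /=.
- by rewrite -[RHS]V0; ring.
- by field; rewrite w0n.
- by rewrite -[RHS]V1; ring.
- by field; rewrite w1n.
- by field; rewrite v2n.
- by rewrite -[RHS]E2; field; rewrite v2n.
- by field; rewrite v3n.
- by rewrite -[RHS]E3; field; rewrite v3n.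
- by field; rewrite v4n.
- by rewrite -[RHS]E4; ring.
Qed.

End FiveByFive.

(** * Reduction to the 5 x 5 case by Schur complements *)

Lemma Schur_kernel_rank p m k (A : 'M[R]_p) (B : 'M[R]_(p, m)) (C : 'M[R]_(m, p))
    (E : 'M[R]_m) (K : 'M[R]_(p, k)) :
  \det E != 0 -> (\det E *: A - B *m \adj E *m C) *m K = 0 ->
  (\rank K + \rank (block_mx A B C E) <= p + m)%N.
Proof.
move=> E0 SK; have Eunit : E \in unitmx by rewrite unitmxE unitfE.
(* Each kernel vector [u] of the Schur complement extends by [- invmx E *m C *m u] to a kernel
   vector of the block matrix. *)
pose K' := col_mx K (- (invmx E *m C *m K)).
have rkK : (\rank K <= \rank K')%N.
  by rewrite -[K in (\rank K <= _)%N](col_mxKu _ (- (invmx E *m C *m K)))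
    -[K' in usubmx K']mul1mx -mul_usub_mx mxrankM_maxr.
apply: leq_trans (leq_add rkK (leqnn _)) _; rewrite addnC.
apply: mulmx0_rank_max; rewrite /K'.
rewrite mul_block_col !mulmxN !mulmxA mulmxV// mul1mx subrr.
rewrite -!mulmxA !mulmxA -mulmxBl.
have -> : A - B *m invmx E *m C = (\det E)^-1 *: (\det E *: A - B *m \adj E *m C).
  rewrite scalerBr scalerA mulVf// scale1r /invmx Eunit.
  by rewrite -scalemxAr -scalemxAl.
by rewrite -scalemxAl SK scaler0 col_mx0.
Qed.

(* The Schur complement of the lower right block, multiplied by the determinant
   of this block in order to be polynomial in [M]. *)
Definition schur5 m (M : 'M[R]_(5 + m)) (i j : nat) : R :=
  (\det (drsubmx M) *: ulsubmx M -
   ursubmx M *m \adj (drsubmx M) *m dlsubmx M) (inord i) (inord j).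

Lemma corank2_completion m (M : 'M[R]_(5 + m)) :
  \det (drsubmx M) != 0 -> nondegenerate5 (schur5 M) != 0 ->
  exists M' : 'M[R]_(5 + m), (\rank M' <= 3 + m)%N /\
    forall i j, M' i j != M i j -> (i == j) && (i < 5)%N.
Proof.
set d := \det _ => d0 /corank2_completion5[x [K [rkK xK]]].
pose B := ursubmx M *m \adj (drsubmx M) *m dlsubmx M.
(* Chosen so that [d *: A' - B] has diagonal [x] and agrees with the Schur complement of [M] off the
   diagonal. *)
pose A' := \matrix_(i, j)
  if i == j then (x i + B i i) / d else ulsubmx M i j.
exists (block_mx A' (ursubmx M) (dlsubmx M) (drsubmx M)); split.
  rewrite -(leq_add2l 2%N) -{1}rkK; apply: Schur_kernel_rank => //.
  rewrite -[RHS]xK; congr (_ *m _); apply/matrixP => i j; rewrite -/d -/B.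
  rewrite !mxE; case: eqP => [<-|_]; first by field.
  by rewrite /schur5 !inord_val -/d -/B !mxE.
move=> i j; rewrite -[X in _ != fun_of_matrix X i j]submxK.
case: (split_ordP i) => i' ->; case: (split_ordP j) => j' ->.
- rewrite !block_mxEul [A' _ _]mxE.
  by have [<-|] := eqVneq i' j'; rewrite ?eqxx//= ltn_ord.
- by rewrite !block_mxEur eqxx.
- by rewrite !block_mxEdl eqxx.
- by rewrite !block_mxEdr eqxx.
Qed.

Lemma polyfun_nondegenerate5 (T : Type) (h : (T -> R) -> nat -> nat -> R) :
  (forall i j, polyfun (fun x => h x i j)) ->
  polyfun (fun x => nondegenerate5 (h x)).
Proof.
move=> polyh; rewrite /nondegenerate5 /det3 /= /kcol0 /kcol1 /ker_v2 /ker_v3 /ker_v4.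
by repeat first [exact: polyh | apply: polyfunD | apply: polyfunM | apply: polyfunN].
Qed.

Lemma polyfun_mulmx (T : Type) m n p (A : (T -> R) -> 'M[R]_(m, n))
    (B : (T -> R) -> 'M[R]_(n, p)) :
  (forall i j, polyfun (fun x => A x i j)) ->
  (forall i j, polyfun (fun x => B x i j)) ->
  forall i j, polyfun (fun x => (A x *m B x) i j).
Proof.
move=> polyA polyB i j.
apply: (eq_polyfun (f := fun x => \sum_k A x i k * B x k j)) => [|x].
  by apply: polyfun_sum => k _; exact: polyfunM.
by rewrite mxE.
Qed.

Lemma polyfun_adjugate (T : Type) n (A : (T -> R) -> 'M[R]_n) :
  (forall i j, polyfun (fun x => A x i j)) ->
  forall i j, polyfun (fun x => (\adj (A x)) i j).
Proof.
move=> polyA i j; apply: (eq_polyfun (f := fun x => cofactor (A x) j i)).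
  apply: polyfunM; first exact: polyfun_const.
  apply: polyfun_det => k l.
  apply: (eq_polyfun (f := fun x => A x (lift j k) (lift i l))) => // x.
  by rewrite !mxE.
by move=> x; rewrite mxE.
Qed.

Lemma polyfun_schur5 (T : Type) m (M : (T -> R) -> 'M[R]_(5 + m)) :
  (forall i j, polyfun (fun x => M x i j)) ->
  forall i j, polyfun (fun x => schur5 (M x) i j).
Proof.
move=> polyM i j.
have polyul k l : polyfun (fun x => ulsubmx (M x) k l).
  by apply: eq_polyfun (polyM (lshift m k) (lshift m l)) _ => x; rewrite !mxE.
have polyur k l : polyfun (fun x => ursubmx (M x) k l).
  by apply: eq_polyfun (polyM (lshift m k) (rshift 5 l)) _ => x; rewrite !mxE.
have polydl k l : polyfun (fun x => dlsubmx (M x) k l).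
  by apply: eq_polyfun (polyM (rshift 5 k) (lshift m l)) _ => x; rewrite !mxE.
have polydr k l : polyfun (fun x => drsubmx (M x) k l).
  by apply: eq_polyfun (polyM (rshift 5 k) (rshift 5 l)) _ => x; rewrite !mxE.
have polyB := polyfun_mulmx (polyfun_mulmx polyur (polyfun_adjugate polydr)) polydl.
have polyd := polyfun_det polydr.
apply: eq_polyfun (polyfunD (polyfunM polyd (polyul (inord i) (inord j)))
  (polyfunN (polyB (inord i) (inord j)))) _ => x.
by rewrite /schur5 !mxE.
Qed.

Lemma generic_rank_le m (S : {set 'I_(5 + m) * 'I_(5 + m)}) :
  (forall i j, (i, j) \notin S -> i = j) ->
  (forall i : 'I_(5 + m), (i < 5)%N -> (i, i) \notin S) ->
  exists G : ({ij | ij \in S} -> R) -> R,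
    [/\ polyfun G, exists x, G x != 0 &
    forall A : partial_filling R S, G A != 0 ->
      exists2 M, is_completion A M & (\rank M <= 3 + m)%N].
Proof.
move=> Sdiag S5.
(* Unspecified entries start at 1; only the first five diagonal ones are changed later. The test
   matrix [Z] below has unit diagonal, so [X] reproduces it. *)
pose X (x : {ij | ij \in S} -> R) : 'M[R]_(5 + m) :=
  \matrix_(i, j) oapp x 1 (insub (i, j)).
have polyX i j : polyfun (fun x => X x i j).
  apply: (eq_polyfun (f := fun x => oapp x 1 (insub (i, j)))) => [|x].
    by case: insub => [u|]; [exact: polyfun_proj|exact: polyfun_const].
  by rewrite mxE.
exists (fun x => \det (drsubmx (X x)) * nondegenerate5 (schur5 (X x))); split.
- apply: polyfunM.
    apply: polyfun_det => i j.
    by apply: eq_polyfun (polyX (rshift 5 i) (rshift 5 j)) _ => x; rewrite !mxE.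
  by apply: polyfun_nondegenerate5 => i j; exact: polyfun_schur5.
(* A 5 x 5 matrix at which [nondegenerate5] equals 1. Bordered by an identity block, it is its own
   Schur complement. *)
- pose t : seq (seq R) := [:: [:: 1; 0; 0; 1; 1]; [:: 0; 1; 1; 1; 0];
    [:: 0; 0; 1; 0; 1]; [:: 1; 1; 0; 1; 0]; [:: 0; 0; 0; 1; 1]].
  pose T5 : 'M[R]_5 := \matrix_(i, j) (nth [::] t i)`_j.
  pose Z : 'M[R]_(5 + m) := block_mx T5 0 0 1%:M.
  have Z1 i : Z i i = 1.
    case: (split_ordP i) => k ->; rewrite ?block_mxEul ?block_mxEdr mxE ?eqxx//.
    by case: k => [[|[|[|[|[|//]]]]] ?].
  exists (fun u => Z (val u).1 (val u).2).
  have -> : X (fun u => Z (val u).1 (val u).2) = Z.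
    apply/matrixP => i j; rewrite mxE; case: insubP => [u _ /= ->//|/Sdiag <-].
    by rewrite /= Z1.
  rewrite block_mxKdr det1 mul1r.
  have hE i j : (i < 5)%N -> (j < 5)%N -> schur5 Z i j = (nth [::] t i)`_j.
    move=> i5 j5; rewrite /schur5 block_mxKdr block_mxKur det1 scale1r !mul0mx.
    by rewrite subr0 block_mxKul mxE !inordK.
  suff -> : nondegenerate5 (schur5 Z) = 1 by exact: oner_neq0.
  rewrite /nondegenerate5 /det3 /= /kcol0 /kcol1 /ker_v2 /ker_v3 /ker_v4 !hE//=.
  by ring.
move=> A; rewrite mulf_eq0 negb_or => /andP[d0 /(corank2_completion d0)].
move=> [M [rkM MX]]; exists M => // i j ijS.
have -> : A (exist _ (i, j) ijS) = X A i j by rewrite mxE insubT.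
apply: contraTeq isT => /MX/andP[/eqP ij i5].
by move: ijS; rewrite -ij (negbTE (S5 i i5)).
Qed.

End CorankTwo.

(** * Both inclusions for the set of typical coranks *)

Theorem corollary3p14 (R : realType) (n : nat) (hn : 5 <= n < 9)
    (N : nat) (hN : n <= N) :
  typical_coranks R (~: diag_positions N n)%SET = [set 2]%classic.
Proof.
have [n5 n9] := andP hn.
have [m Nm] : exists m, N = 5 + m by exists (N - 5); lia.
rewrite {N}Nm in hN *; set S := finset.setC _.
have SE i j : ((i, j) \notin S) = (i == j) && (i < n).
  by rewrite !inE negbK.
(* The bound [n < 9] makes the specified entries outnumber the parameters of rank [N - 3]. *)
have cardS : (5 + m) * (5 + m) - 3 * 3 < #|S|.
  have := cardsC (diag_positions (5 + m) n); rewrite -/S card_prod card_ord.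
  have : #|diag_positions (5 + m) n| <= n.
    have -> : diag_positions (5 + m) n =
        [set (widen_ord hN k, widen_ord hN k) | k in 'I_n]%SET.
      apply/setP => -[i j]; rewrite inE /=; apply/andP/imsetP => /=.
        move=> [/eqP <- ltin]; exists (Ordinal ltin) => //.
        by congr pair; exact: val_inj.
      by move=> [k _ [-> ->]]; rewrite eqxx /= ltn_ord.
    by rewrite (leq_trans (leq_imset_card _ _))// card_ord.
  move: (#|diag_positions _ _|) (#|S|) => a b; lia.
have [|G [polyG G0 GA]] := generic_rank_gt R _ cardS; first by lia.
have [i j|i i5|P [polyP P0 PA]] := @generic_rank_le R m S.
- by rewrite SE => /andP[/eqP].
- by rewrite SE eqxx (leq_trans i5).
have polyPG := polyfunM polyP polyG.
have PG0 := polyfunM_neq0 polyP polyG P0 G0.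
(* Off the hypersurface [P * G = 0] the minimum rank is exactly [N - 2 = 3 + m]. *)
have PG_min A : (P A * G A != 0)%R -> is_min_completion_rank A (3 + m).
  rewrite GRing.mulf_eq0 negb_or => /andP[/PA[M AM rkM] GA0].
  have lb M' : is_completion A M' -> 3 + m <= \rank M'.
    by move=> /GA/(_ GA0); lia.
  by split=> //; exists M => //; apply/eqP; rewrite eqn_leq rkM lb.
apply/seteqP; split=> [k [r [V [oV V0 Vmin]] ->]|k ->] /=.
  (* By density any open witness [V] meets this locus, and the minimum rank at a common point is
     unique. *)
  have [A VA PGA] := polyfun_neq0_dense polyPG PG0 oV V0.
  have [[M AM rkM] leM] := Vmin A VA.
  have [[M' AM' rkM'] leM'] := PG_min A PGA.
  have := leM M' AM'; have := leM' M AM; lia.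
exists (3 + m); last by lia.
exists [set A | (P A * G A != 0)%R]%classic; split => //.
exact: open_polyfun_neq0.
Qed.
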